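(* Let $M,\ell\ge 1$, let $\Psi\in\mathbb{R}^{M\times \ell}$, let $\Sigma_{\mathrm{pr}}\in\mathbb{R}^{\ell\times\ell}$ be symmetric positive definite, and let $\sigma_{\mathrm{ch}}>\sigma_{\exp}>0$. Let $S=[S_{\mathrm{ch}},S_{\exp}]$ and $\widetilde S=[\widetilde S_{\mathrm{ch}},\widetilde S_{\exp}]$ be two selection lists (pairs of subsets of $\{1,\dots,M\}$) such that $$S_{\mathrm{ch}}\cap S_{\exp}=\widetilde S_{\mathrm{ch}}\cap\widetilde S_{\exp}=\emptyset,\qquad S_j\subseteq\widetilde S_j\ \text{ for } j\in\{\mathrm{ch},\exp\}.$$ Then the D-optimality criterion $\Phi_D$ satisfies: 1. (Monotonicity) $\Phi_D(S)\le\Phi_D(\widetilde S)$. 2. (Submodularity) For every $i\in\{1,\dots,M\}$ with $i\notin\widetilde S_{\mathrm{ch}}\cup\widetilde S_{\exp}$ and every $j\in\{\mathrm{ch},\exp\}$, $$\Phi_D\left(S^{(j,i)}\right)-\Phi_D(S)\ \ge\ \Phi_D\left(\widetilde S^{(j,i)}\right)-\Phi_D(\widetilde S).$$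
   Context: Candidate sensor locations are $\{1,\dots,M\}$, and there are two sensor types (fidelities): cheap ($\mathrm{ch}$) and expensive ($\exp$), with measurement noise standard deviations $\sigma_{\mathrm{ch}}>\sigma_{\exp}>0$. $\Psi\in\mathbb{R}^{M\times\ell}$ is the modal basis restricted to the candidate locations and $\Sigma_{\mathrm{pr}}\in\mathbb{R}^{\ell\times\ell}$ is the (symmetric positive definite) prior covariance; $\Sigma_{\mathrm{pr}}^{1/2}$ is its symmetric positive definite square root. For a selection list $S=[S_{\mathrm{ch}},S_{\exp}]$ of disjoint subsets of $\{1,\dots,M\}$ put $k_j=|S_j|$. The selection matrix $\mathbf{S}_j\in\{0,1\}^{M\times k_j}$ consists of the columns of the $M\times M$ identity matrix indexed by $S_j$, and $\mathbf{S}=[\mathbf{S}_{\mathrm{ch}}\ \ \mathbf{S}_{\exp}]$. The noise covariance is the block-diagonal matrix $\Sigma_{\mathrm{noise}}=\mathrm{diag}(\sigma_{\mathrm{ch}}^2 I_{k_{\mathrm{ch}}},\ \sigma_{\exp}^2 I_{k_{\exp}})$. The inverse posterior covariance is $$\Sigma_{\mathrm{post}}^{-1}(S)=\Psi^\top\mathbf{S}\,\Sigma_{\mathrm{noise}}^{-1}\,\mathbf{S}^\top\Psi+\Sigma_{\mathrm{pr}}^{-1},$$ and the D-optimality criterion is $$\Phi_D(S)=\log\det\left(\Sigma_{\mathrm{pr}}^{1/2}\,\Sigma_{\mathrm{post}}^{-1}(S)\,\Sigma_{\mathrm{pr}}^{1/2}\right).$$ Empty products (when $S_j=\emptyset$)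 contribute the zero matrix. For a location $i$, $S^{(\mathrm{ch},i)}=[S_{\mathrm{ch}}\cup\{i\},\,S_{\exp}]$ and $S^{(\exp,i)}=[S_{\mathrm{ch}},\,S_{\exp}\cup\{i\}]$. *)

(* Defs.v *)
From mathcomp Require Import all_boot all_order all_algebra.
From mathcomp Require Import complex.
From mathcomp Require Import boolp classical_sets reals exp.

Set Implicit Arguments.
Unset Strict Implicit.
Unset Printing Implicit Defensive.

Import Order.TTheory GRing.Theory Num.Theory.

Local Open Scope ring_scope.

Definition posdefmx (R : realType) (n : nat) (A : 'M[R]_n) : Prop :=
  A \is symmetricmx /\ forall x : 'cV[R]_n, x != 0 -> 0 < (x^T *m A *m x) 0 0.

(* The symmetric positive definite square root; [sqrtmxP] and [sqrtmx_unique]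
   below show that it exists and is unique when [A] is positive definite.  The
   default value 0 is only used for other matrices. *)
Definition sqrtmx (R : realType) (n : nat) (A : 'M[R]_n) : 'M[R]_n :=
  xget 0 [set Q : 'M[R]_n | posdefmx Q /\ Q *m Q = A]%classic.

Variant fidelity := cheap | expensive.

Definition selection (M : nat) := fidelity -> {set 'I_M}.

Definition add_sensor (M : nat) (S : selection M) (j : fidelity) (i : 'I_M) :
    selection M :=
  match j with
  | cheap => fun k => if k is cheap then i |: S k else S k
  | expensive => fun k => if k is expensive then i |: S k else S k
  end.

(* The columns of the identity matrix indexed by [A], in increasing order. *)
Definition selmx (R : realType) (M : nat) (A : {set 'I_M}) : 'M[R]_(M, #|A|) :=
  colsub (fun k : 'I_#|A| => enum_val k) 1%:M.

Definition selection_mx (R : realType) (M : nat) (S : selection M) :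
    'M[R]_(M, #|S cheap| + #|S expensive|) :=
  row_mx (selmx R (S cheap)) (selmx R (S expensive)).

Definition noise_cov (R : realType) (M : nat) (sigma : fidelity -> R)
    (S : selection M) : 'M[R]_(#|S cheap| + #|S expensive|) :=
  block_mx (sigma cheap ^+ 2)%:M 0 0 (sigma expensive ^+ 2)%:M.

Definition inv_post_cov (R : realType) (M l : nat) (Psi : 'M[R]_(M, l))
    (Sigma_pr : 'M[R]_l) (sigma : fidelity -> R) (S : selection M) : 'M[R]_l :=
  Psi^T *m selection_mx R S *m invmx (noise_cov sigma S)
    *m (selection_mx R S)^T *m Psi + invmx Sigma_pr.

Definition Phi_D (R : realType) (M l : nat) (Psi : 'M[R]_(M, l))
    (Sigma_pr : 'M[R]_l) (sigma : fidelity -> R) (S : selection M) : R :=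
  ln (\det (sqrtmx Sigma_pr *m inv_post_cov Psi Sigma_pr sigma S
              *m sqrtmx Sigma_pr)).

Lemma posdefmx_sym (R : realType) n (A : 'M[R]_n) : posdefmx A -> A^T = A.
Proof.
by case=> /is_hermitianmxP; rewrite expr0 scale1r map_mx_id // => {2}->.
Qed.

Lemma sym_symmetricmx (R : realType) n (A : 'M[R]_n) :
  A^T = A -> A \is symmetricmx.
Proof.
by move=> sA; apply/is_hermitianmxP; rewrite expr0 scale1r map_mx_id.
Qed.

Lemma normcv_ge0 (R : realType) n (x : 'cV[R]_n) : 0 <= (x^T *m x) 0 0.
Proof. by rewrite mxE sumr_ge0 // => i _; rewrite mxE -expr2 sqr_ge0. Qed.

Lemma normcv_gt0 (R : realType) n (x : 'cV[R]_n) :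
  x != 0 -> 0 < (x^T *m x) 0 0.
Proof.
move=> x0; rewrite lt_def normcv_ge0 andbT; apply: contra x0.
rewrite mxE psumr_eq0 => [/allP h|i _]; last by rewrite mxE -expr2 sqr_ge0.
apply/eqP/matrixP => i j; rewrite ord1 [RHS]mxE.
have /(_ (mem_index_enum i)) := h i.
by rewrite mxE -expr2 sqrf_eq0 => /eqP.
Qed.

Lemma posdefmx_eigen_gt0 (R : realType) n (A : 'M[R]_n) (a : R) :
  posdefmx A -> eigenvalue A a -> 0 < a.
Proof.
move=> [_ pA] /eigenvalueP [v vA v0].
have vT0 : v^T != 0 by rewrite -(inj_eq trmx_inj) trmxK trmx0.
have := pA _ vT0; rewrite trmxK vA -scalemxAl mxE.
by rewrite pmulr_lgt0 //; have := normcv_gt0 vT0; rewrite trmxK.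
Qed.

Lemma interpolation (R : fieldType) (f : R -> R) (s : seq R) :
  exists p : {poly R}, {in s, forall x, p.[x] = f x}.
Proof.
elim: s => [|x s [p ps]]; first by exists 0.
have [xs|xs] := boolP (x \in s).
  by exists p => y; rewrite inE => /orP[/eqP->|ys]; exact: ps.
pose q := \prod_(y <- s) ('X - y%:P).
have qx : q.[x] != 0 by have := root_prod_XsubC s x; rewrite /root => ->.
exists (p + ((f x - p.[x]) / q.[x]) *: q) => y.
rewrite inE hornerD hornerZ => /orP[/eqP->|ys].
  by rewrite divfK // addrC subrK.
by rewrite (_ : q.[y] = 0) ?mulr0 ?addr0 ?ps //; apply/rootP; rewrite root_prod_XsubC.
Qed.

Lemma trmx_horner_mx (R : realType) n (A : 'M[R]_n.+1) (p : {poly R}) :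
  A^T = A -> (horner_mx A p)^T = horner_mx A p.
Proof.
move=> sA; elim/poly_ind: p => [|p c IH]; first by rewrite rmorph0 trmx0.
rewrite rmorphD rmorphM /= horner_mx_X horner_mx_C linearD /= tr_scalar_mx.
by rewrite [(_ * _)^T]trmx_mul IH sA; congr (_ + _); exact/comm_mx_horner.
Qed.

Lemma posdefmx_horner0 (R : realType) n (A : 'M[R]_n.+1) :
    posdefmx A -> exists s : seq R, {in s, forall a, 0 < a} /\
  forall q : {poly R}, {in s, forall a, q.[a] = 0} -> horner_mx A q = 0.
Proof.
move=> pA; pose toC := real_complex R; pose AC := map_mx toC A.
have hA : AC \is hermsymmx.
  apply/is_hermitianmxP; rewrite expr0 scale1r.
  apply/matrixP => i j; rewrite !mxE.
  by rewrite [RHS]conjc_real -{1}(posdefmx_sym pA) mxE.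
have /mxOverP dR := hermitian_spectral_diag_real hA.
have /hermitian_normalmx /orthomx_spectralP := hA.
have := spectral_unit AC.
set P := spectralmx AC; set d := spectral_diag AC => uP eA.
pose a i := complex.Re (d 0 i).
have da i : d 0 i = toC (a i).
  by have /Creal_ImP := dR 0 i; rewrite /a; case: (d 0 i) => x y;
    rewrite -complexIm /= => -[->].
have eig i : eigenvalue A (a i).
  rewrite eigenvalue_root_char -(fmorph_root toC) -[X in root _ X]/(toC (a i)) -da.
  rewrite map_char_poly -eigenvalue_root_char.
  apply/eigenvalueP; exists (row i P).
    rewrite -row_mul -/AC eA !mulmxA mulmxV // mul1mx row_mul row_diag_mx.
    by rewrite -scalemxAl -rowE.
  apply/eqP => /(congr1 (mulmx^~ (invmx P))).
  rewrite -row_mul mulmxV // mul0mx => /matrixP /(_ 0 i).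
  by rewrite !mxE eqxx => /eqP; rewrite oner_eq0.
exists [seq a i | i : 'I_n.+1]; split.
  by move=> _ /mapP[i _ ->]; exact: posdefmx_eigen_gt0 (eig i).
move=> q q0; apply: (@map_mx_inj _ _ toC); rewrite map_horner_mx map_mx0 -/AC eA.
rewrite horner_mx_uconjC // horner_mx_diag.
rewrite (_ : map_mx _ d = 0) ?linear0 ?mulmx0 ?mul0mx //.
apply/matrixP => i j; rewrite !mxE ord1 da horner_map q0 ?rmorph0 //.
by apply/mapP; exists j; rewrite ?mem_enum.
Qed.

Lemma sqrtmx_exists (R : realType) n (A : 'M[R]_n) :
  posdefmx A -> exists Q, posdefmx Q /\ Q *m Q = A.
Proof.
case: n A => [|n] A pA; first by exists A; rewrite [A]thinmx0 mul0mx; rewrite [A]thinmx0 in pA.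
have [s [s0 hs]] := posdefmx_horner0 pA.
have [p ps] := interpolation (fun x => Num.sqrt (Num.sqrt x)) s.
pose r := horner_mx A p.
have r4 : (r *m r) *m (r *m r) = A.
  apply/eqP; rewrite -subr_eq0; apply/eqP.
  rewrite -(hs (p * p * (p * p) - 'X)); first by rewrite rmorphB !rmorphM /= horner_mx_X.
  move=> a /[dup] /s0 a0 /ps pa; rewrite hornerD hornerN hornerX !hornerM pa.
  by rewrite -!expr2 sqr_sqrtr ?sqrtr_ge0 // sqr_sqrtr ?subrr // ltW.
have rT : r^T = r by apply/trmx_horner_mx/posdefmx_sym.
exists (r *m r); split=> //; split.
  by apply: sym_symmetricmx; rewrite trmx_mul rT.
move=> x x0; rewrite -{1}rT !mulmxA -trmx_mul -mulmxA normcv_gt0 //.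
apply: contraTneq (pA.2 _ x0) => rx.
by rewrite -r4 -!mulmxA rx !mulmx0 mxE ltxx.
Qed.

Lemma posdefmx_tr_eq0 (R : realType) n (Q D : 'M[R]_n) : posdefmx Q ->
  0 <= \tr (D^T *m Q *m D) /\ (\tr (D^T *m Q *m D) = 0 -> D = 0).
Proof.
move=> [_ pQ].
have E i : (D^T *m Q *m D) i i = ((col i D)^T *m Q *m col i D) 0 0.
  rewrite !mxE; apply: eq_bigr => k _; rewrite !mxE; congr (_ * _).
  by apply: eq_bigr => m _; rewrite !mxE.
have ge i : 0 <= (D^T *m Q *m D) i i.
  rewrite E; have [->|/pQ/ltW//] := eqVneq (col i D) 0.
  by rewrite mulmx0 mxE.
split; first by apply: sumr_ge0.
move/eqP; rewrite psumr_eq0 // => /allP h.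
apply/matrixP => i j; rewrite mxE.
have [/matrixP /(_ i 0)|/pQ] := eqVneq (col j D) 0; first by rewrite !mxE.
by have := h j (mem_index_enum j); rewrite E => /eqP ->; rewrite ltxx.
Qed.

Lemma sqrtmx_uniq (R : realType) n (Q1 Q2 : 'M[R]_n) :
  posdefmx Q1 -> posdefmx Q2 -> Q1 *m Q1 = Q2 *m Q2 -> Q1 = Q2.
Proof.
move=> p1 p2 e; apply/eqP; rewrite -subr_eq0; apply/eqP; set D := Q1 - Q2.
have DT : D^T = D by rewrite linearB /= !posdefmx_sym.
have [g1 z1] := posdefmx_tr_eq0 D p1; have [g2 _] := posdefmx_tr_eq0 D p2.
apply: z1; apply/eqP; rewrite eq_le g1 andbT.
suff -> : \tr (D^T *m Q1 *m D) = - \tr (D^T *m Q2 *m D) by rewrite oppr_le0.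
apply/eqP; rewrite -subr_eq0 opprK DT.
rewrite [X in _ + X]mxtrace_mulC -!mulmxA -linearD /= -mulmxDr.
rewrite (_ : Q1 *m D + D *m Q2 = 0) ?mulmx0 ?linear0 //.
by rewrite mulmxBr mulmxBl e addrA subrK subrr.
Qed.

Lemma sqrtmxP (R : realType) n (A : 'M[R]_n) : posdefmx A ->
  posdefmx (sqrtmx A) /\ sqrtmx A *m sqrtmx A = A.
Proof. by move=> /sqrtmx_exists; exact: xgetPex. Qed.

Lemma sqrtmx_unique (R : realType) n (A Q : 'M[R]_n) :
  posdefmx Q -> Q *m Q = A -> sqrtmx A = Q.
Proof.
move=> pQ QA; apply: xget_unique => [//|Q' [pQ' Q'A]].
by apply: sqrtmx_uniq; rewrite // Q'A.
Qed.

(* Main.v *)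
Require Import Defs.
From mathcomp Require Import all_boot all_order all_algebra.
From mathcomp Require Import reals exp.
From mathcomp Require Import ring lra.

Import Order.TTheory GRing.Theory Num.Theory.
Local Open Scope ring_scope.

(** Write Lambda(S) for the inverse posterior covariance.  Each selected sensor
contributes a nonnegative multiple of the rank-one matrix u_k u_k^T, where
u_k^T is the k-th row of Psi, so Lambda(S) is the fixed matrix Sigma_pr^-1
plus a combination of these whose weights depend on S ([inv_post_covE]) and
grow with S ([precision_le]).  Since det (Q L Q) = det (Q^2) det L, the
criterion is ln (det Sigma_pr * det Lambda(S)) ([Phi_DE]), and everything is a
question about determinants under rank-one updates.

The matrix determinant lemma det (A + c u u^T) = det A * (1 + c u^T A^-1 u)
([det_rank1_update]) answers both parts.  The extra factor is at least 1, and
iterating over the sensors gives monotonicity ([weighted_gram_update]).  The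
marginal gain of location i is ln (1 + c u_i^T Lambda(S)^-1 u_i), with the same
c = sigma_j^-2 for S and for the larger selection, so submodularity amounts to
u^T B^-1 u <= u^T A^-1 u whenever A <= B in the Loewner order
([qform_inv_antitone]). *)

(** * Determinants and rank-one updates *)

(** The two sides are the Schur complements of the matrix with block rows
(1, v) and (-u, 1), computed from either diagonal block. *)
Lemma det_1_add_mulmx {R : comPzRingType} {m n : nat} (v : 'M[R]_(m, n))
    (u : 'M[R]_(n, m)) :
  \det (1%:M + v *m u) = \det (1%:M + u *m v).
Proof.
have E : block_mx 1%:M 0 u 1%:M *m block_mx (1%:M + v *m u) v 0 1%:M
    *m block_mx 1%:M 0 (- u) 1%:M = block_mx 1%:M v 0 (1%:M + u *m v).
  rewrite -mulmxA !mulmx_block !mul1mx !mulmx1 !mul0mx !mulmx0 ?mulmxN !add0r.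
  by rewrite !addr0 addrK mulmx1 subrr addrC.
have := congr1 determinant E.
by rewrite !det_mulmx !det_ublock !det_lblock !det1 !mulr1 !mul1r.
Qed.

Definition qform {R : realType} {n : nat} (A : 'M[R]_n) (x : 'cV[R]_n) : R :=
  (x^T *m A *m x) 0 0.

(** The matrix determinant lemma. *)
Lemma det_rank1_update {R : realType} {n : nat} (A : 'M[R]_n) (c : R)
    (u : 'cV[R]_n) :
  A \in unitmx ->
  \det (A + c *: (u *m u^T)) = \det A * (1 + c * qform (invmx A) u).
Proof.
move=> uA.
have -> : A + c *: (u *m u^T) = A *m (1%:M + (c *: (invmx A *m u)) *m u^T).
  by rewrite mulmxDr mulmx1 -scalemxAl -scalemxAr -!mulmxA mulKVmx.
rewrite det_mulmx det_1_add_mulmx det_mx11 mxE [1%:M 0 0]mxE eqxx /=.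
by rewrite -scalemxAr mulmxA mxE.
Qed.

(** * Positive definite matrices *)

Lemma qformD {R : realType} {n : nat} (A B : 'M[R]_n) (x : 'cV[R]_n) :
  qform (A + B) x = qform A x + qform B x.
Proof. by rewrite /qform mulmxDr mulmxDl mxE. Qed.

Lemma qform_rank1_ge0 {R : realType} {n : nat} (c : R) (u x : 'cV[R]_n) :
  0 <= c -> 0 <= qform (c *: (u *m u^T)) x.
Proof.
move=> c0; rewrite /qform -scalemxAr -scalemxAl mxE mulr_ge0 //.
have -> : x^T *m (u *m u^T) *m x = (u^T *m x)^T *m (u^T *m x).
  by rewrite trmx_mul trmxK !mulmxA.
exact: normcv_ge0.
Qed.

Lemma posdefmx_qform_ge0 {R : realType} {n : nat} {A : 'M[R]_n} (x : 'cV[R]_n) :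
  posdefmx A -> 0 <= qform A x.
Proof.
move=> [_ pA]; have [->|/pA/ltW//] := eqVneq x 0.
by rewrite /qform mulmx0 mxE.
Qed.

(** The determinant is a square, that of [sqrtmx A], so only its vanishing has
to be excluded. *)
Lemma posdefmx_det_gt0 {R : realType} {n : nat} {A : 'M[R]_n} :
  posdefmx A -> 0 < \det A.
Proof.
move=> pA; rewrite lt_def; apply/andP; split.
  apply/negP => /det0P[v v0 vA].
  have vT0 : v^T != 0 by rewrite -(inj_eq trmx_inj) trmxK trmx0.
  by have := pA.2 _ vT0; rewrite trmxK vA mul0mx mxE ltxx.
have [_ <-] := sqrtmxP pA.
by rewrite det_mulmx -expr2 sqr_ge0.
Qed.

Lemma posdefmx_unit {R : realType} {n : nat} {A : 'M[R]_n} :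
  posdefmx A -> A \in unitmx.
Proof. by move/posdefmx_det_gt0/lt0r_neq0; rewrite unitmxE unitfE. Qed.

(** With y = A^-1 x one has x^T A^-1 x = y^T A y. *)
Lemma posdefmx_inv {R : realType} {n : nat} {A : 'M[R]_n} :
  posdefmx A -> posdefmx (invmx A).
Proof.
move=> pA; have uA := posdefmx_unit pA; have sA := posdefmx_sym pA.
split; first by apply: sym_symmetricmx; rewrite trmx_inv sA.
move=> x x0.
have y0 : invmx A *m x != 0.
  by apply: contra_neq x0 => y0; rewrite -(mulKVmx uA x) y0 mulmx0.
by have := pA.2 _ y0; rewrite trmx_mul trmx_inv sA -!mulmxA mulKVmx.
Qed.

Lemma posdefmx_rank1_update {R : realType} {n : nat} {A : 'M[R]_n} (c : R)
    (u : 'cV[R]_n) :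
  posdefmx A -> 0 <= c -> posdefmx (A + c *: (u *m u^T)).
Proof.
move=> pA c0; split.
  apply: sym_symmetricmx.
  by rewrite linearD linearZ /= trmx_mul trmxK (posdefmx_sym pA).
move=> x x0; rewrite -/(qform _ x) qformD.
by rewrite ltr_wpDr ?qform_rank1_ge0 //; exact: pA.2.
Qed.

(** Inversion reverses the Loewner order.  With z = A^-1 x and y = B^-1 x,
positivity of A at z - y gives 2 x^T y <= x^T z + y^T A y, while
y^T A y <= y^T B y = x^T y. *)
Lemma qform_inv_antitone {R : realType} {n : nat} {A B : 'M[R]_n} :
  posdefmx A -> posdefmx B -> (forall x, qform A x <= qform B x) ->
  forall x, qform (invmx B) x <= qform (invmx A) x.
Proof.
move=> pA pB leAB x.
have [uA uB] := (posdefmx_unit pA, posdefmx_unit pB).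
have [sA sB] := (posdefmx_sym pA, posdefmx_sym pB).
set y := invmx B *m x; set z := invmx A *m x.
have yB : qform B y = qform (invmx B) x.
  by rewrite /qform /y trmx_mul trmx_inv sB -!mulmxA mulKVmx.
have zyA : qform A (z - y) =
    qform (invmx A) x - 2 * qform (invmx B) x + qform A y.
  have zA : z^T *m A = x^T by rewrite trmx_mul trmx_inv sA mulmxKV.
  have Az : A *m z = x by rewrite mulKVmx.
  have yx : y^T *m x = x^T *m y.
    by rewrite trmx_mul trmx_inv sB -mulmxA.
  rewrite /qform [(z - y)^T]linearB /= mulmxBl zA mulmxBr !mulmxBl.
  rewrite -(mulmxA y^T A z) Az yx !mulmxA.
  rewrite -(mulmxA x^T (invmx A)) -(mulmxA x^T (invmx B)) -/y -/z !mxE.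
  by ring.
have := posdefmx_qform_ge0 (z - y) pA; have := leAB y.
by rewrite zyA yB; lra.
Qed.

(** * Weighted sums of rank-one matrices *)

Definition weighted_gram {R : realType} {M l : nat} (Psi : 'M[R]_(M, l))
    (w : 'I_M -> R) : 'M[R]_l :=
  \sum_i w i *: (col i Psi^T *m (col i Psi^T)^T).

Lemma weighted_gramD {R : realType} {M l : nat} (Psi : 'M[R]_(M, l))
    (w v : 'I_M -> R) :
  weighted_gram Psi (fun i => w i + v i) =
  weighted_gram Psi w + weighted_gram Psi v.
Proof. by rewrite -big_split; apply: eq_bigr => i _; rewrite scalerDl. Qed.

Lemma weighted_gram_delta {R : realType} {M l : nat} (Psi : 'M[R]_(M, l))
    (i : 'I_M) (c : R) :
  weighted_gram Psi (fun k => c *+ (k == i)) =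
  c *: (col i Psi^T *m (col i Psi^T)^T).
Proof.
rewrite /weighted_gram (bigD1 i) //= eqxx mulr1n big1 ?addr0 // => k.
by move/negPf ->; rewrite mulr0n scale0r.
Qed.

(** The rank-one matrices are added one at a time; the three conclusions are
proved together because the determinant lemma at each step needs the current
matrix to be positive definite. *)
Lemma weighted_gram_update {R : realType} {M l : nat} (Psi : 'M[R]_(M, l))
    (w : 'I_M -> R) (A : 'M[R]_l) :
  posdefmx A -> (forall i, 0 <= w i) ->
  [/\ posdefmx (A + weighted_gram Psi w),
      \det A <= \det (A + weighted_gram Psi w) &
      forall x, qform A x <= qform (A + weighted_gram Psi w) x].
Proof.
move=> pA w0; rewrite /weighted_gram.
elim/big_rec: _ => [|i G _ [pG dG qG]]; first by rewrite addr0; split.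
rewrite addrCA addrC; split.
- exact: posdefmx_rank1_update.
- rewrite det_rank1_update ?posdefmx_unit // (le_trans dG) //.
  rewrite ler_peMr ?(ltW (posdefmx_det_gt0 _)) // lerDl mulr_ge0 //.
  exact/posdefmx_qform_ge0/posdefmx_inv.
- by move=> x; rewrite qformD (le_trans (qG x)) // lerDl qform_rank1_ge0.
Qed.

(** * The D-optimality criterion *)

(** The weight of location [i] in the inverse posterior covariance.  For the
disjoint pairs of a selection list at most one summand is nonzero. *)
Definition precision {R : realType} {M : nat} (sigma : fidelity -> R)
    (S : selection M) (i : 'I_M) : R :=
  (sigma cheap ^+ 2)^-1 *+ (i \in S cheap) +
  (sigma expensive ^+ 2)^-1 *+ (i \in S expensive).

(** The contribution of the sensors of one type, whose noise covariance is
scalar: the selection matrix picks the rows of [Psi] at the locations in [A]. *)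
Lemma selmx_gram {R : realType} {M l : nat} (Psi : 'M[R]_(M, l))
    (A : {set 'I_M}) (c : R) :
  Psi^T *m selmx R A *m c%:M *m (selmx R A)^T *m Psi =
  weighted_gram Psi (fun i => c *+ (i \in A)).
Proof.
have tA : (selmx R A)^T *m Psi = rowsub (fun k : 'I_#|A| => enum_val k) Psi.
  by rewrite /selmx trmx_mxsub trmx1 mul_rowsub_mx mul1mx.
have At : Psi^T *m selmx R A = (rowsub (fun k : 'I_#|A| => enum_val k) Psi)^T.
  by rewrite -tA trmx_mul trmxK.
rewrite -mulmxA tA At mul_mx_scalar -scalemxAl /weighted_gram.
apply/matrixP => a b; rewrite summxE !mxE mulr_sumr.
transitivity (\sum_(k in A) c * (Psi k a * Psi k b)).
  by rewrite [RHS]big_enum_val; apply: eq_bigr => k _; rewrite !mxE.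
rewrite big_mkcond; apply: eq_bigr => k _; rewrite !mxE big_ord1 !mxE.
by case: ifP => _; rewrite ?mulr1n // mulr0n mul0r.
Qed.

Lemma inv_post_covE {R : realType} {M l : nat} (Psi : 'M[R]_(M, l))
    (Sigma_pr : 'M[R]_l) (sigma : fidelity -> R) (S : selection M) :
  (forall j, 0 < sigma j) ->
  inv_post_cov Psi Sigma_pr sigma S =
  invmx Sigma_pr + weighted_gram Psi (precision sigma S).
Proof.
move=> s0; rewrite /inv_post_cov addrC; congr (_ + _).
have s2 j : sigma j ^+ 2 \is a GRing.unit.
  by rewrite unitfE expf_neq0 // lt0r_neq0.
rewrite weighted_gramD -!selmx_gram /noise_cov invmx_block_diag; last first.
  by rewrite unitmxE det_ublock !det_scalar unitrM !(unitrX _ (s2 _)).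
rewrite !invmx_scalar /selection_mx mul_mx_row mul_row_block !mulmx0 addr0 add0r.
by rewrite tr_row_mx mul_row_col mulmxDl.
Qed.

Lemma precision_ge0 {R : realType} {M : nat} (sigma : fidelity -> R)
    (S : selection M) (i : 'I_M) :
  0 <= precision sigma S i.
Proof. by rewrite addr_ge0 // mulrn_wge0 // invr_ge0 sqr_ge0. Qed.

Lemma precision_le {R : realType} {M : nat} (sigma : fidelity -> R)
    {S S' : selection M} (i : 'I_M) :
  (forall j, S j \subset S' j) -> precision sigma S i <= precision sigma S' i.
Proof.
move=> subS; have mono j : ((i \in S j) <= (i \in S' j))%N.
  by have /subsetP/(_ i) := subS j; case: (i \in S j) => // ->.
by rewrite lerD // ler_wpMn2l ?mono // invr_ge0 sqr_ge0.
Qed.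

Lemma precision_add {R : realType} {M : nat} (sigma : fidelity -> R)
    {S : selection M} {j : fidelity} {i : 'I_M} (k : 'I_M) : i \notin S j ->
  precision sigma (add_sensor S j i) k =
  precision sigma S k + (sigma j ^+ 2)^-1 *+ (k == i).
Proof.
rewrite /precision; case: j => /= iS; rewrite in_setU1.
  by have [->|_] := eqVneq k i; rewrite ?(negPf iS) ?mulr0n ?addr0 ?add0r 1?addrC.
by have [->|_] := eqVneq k i; rewrite ?(negPf iS) ?mulr0n ?addr0.
Qed.

Lemma inv_post_cov_posdef {R : realType} {M l : nat} (Psi : 'M[R]_(M, l))
    {Sigma_pr : 'M[R]_l} {sigma : fidelity -> R} (S : selection M) :
  posdefmx Sigma_pr -> (forall j, 0 < sigma j) ->
  posdefmx (inv_post_cov Psi Sigma_pr sigma S).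
Proof.
move=> pS s0; rewrite inv_post_covE //.
by have [] := weighted_gram_update Psi (precision sigma S) (invmx Sigma_pr)
  (posdefmx_inv pS) (precision_ge0 sigma S).
Qed.

(** Enlarging the selection adds to the inverse posterior covariance the sum
weighted by the increments of the precisions, which are nonnegative. *)
Lemma inv_post_cov_mono {R : realType} {M l : nat} (Psi : 'M[R]_(M, l))
    {Sigma_pr : 'M[R]_l} {sigma : fidelity -> R} {S S' : selection M} :
  posdefmx Sigma_pr -> (forall j, 0 < sigma j) ->
  (forall j, S j \subset S' j) ->
  let A := inv_post_cov Psi Sigma_pr sigma S in
  let B := inv_post_cov Psi Sigma_pr sigma S' in
  \det A <= \det B /\ forall x, qform A x <= qform B x.
Proof.
move=> pS s0 subS A B.
have BE : B = A + weighted_gram Psi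
    (fun i => precision sigma S' i - precision sigma S i).
  rewrite /A /B !inv_post_covE // -addrA -weighted_gramD; congr (_ + _).
  by apply: eq_bigr => i _; rewrite addrC subrK.
have pA : posdefmx A by exact: inv_post_cov_posdef.
have [|_ dAB qAB] := weighted_gram_update Psi
  (fun i => precision sigma S' i - precision sigma S i) A pA.
  by move=> i; rewrite subr_ge0 precision_le.
by rewrite BE.
Qed.

Lemma Phi_DE {R : realType} {M l : nat} (Psi : 'M[R]_(M, l))
    {Sigma_pr : 'M[R]_l} (sigma : fidelity -> R) (S : selection M) :
  posdefmx Sigma_pr ->
  Phi_D Psi Sigma_pr sigma S =
  ln (\det Sigma_pr * \det (inv_post_cov Psi Sigma_pr sigma S)).
Proof.
move=> /sqrtmxP[_ sqS].
by rewrite /Phi_D !det_mulmx mulrAC -det_mulmx sqS.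
Qed.

(** By the matrix determinant lemma the ratio of the two determinants involves
[S] only through a quadratic form of the posterior covariance. *)
Lemma Phi_D_gain {R : realType} {M l : nat} (Psi : 'M[R]_(M, l))
    {Sigma_pr : 'M[R]_l} {sigma : fidelity -> R} {S : selection M}
    {j : fidelity} {i : 'I_M} :
  posdefmx Sigma_pr -> (forall k, 0 < sigma k) -> i \notin S j ->
  Phi_D Psi Sigma_pr sigma (add_sensor S j i) - Phi_D Psi Sigma_pr sigma S =
  ln (1 + (sigma j ^+ 2)^-1 *
          qform (invmx (inv_post_cov Psi Sigma_pr sigma S)) (col i Psi^T)).
Proof.
move=> pS s0 iS; have pA := inv_post_cov_posdef Psi S pS s0.
have AE : inv_post_cov Psi Sigma_pr sigma (add_sensor S j i) =
    inv_post_cov Psi Sigma_pr sigma S +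
    (sigma j ^+ 2)^-1 *: (col i Psi^T *m (col i Psi^T)^T).
  rewrite !inv_post_covE // -addrA -weighted_gram_delta -weighted_gramD.
  by congr (_ + _); apply: eq_bigr => k _; rewrite precision_add.
have dS := posdefmx_det_gt0 pS.
have pAj := inv_post_cov_posdef Psi (add_sensor S j i) pS s0.
rewrite !Phi_DE // -ln_div ?posrE ?mulr_gt0 ?(posdefmx_det_gt0 pA) //;
  last exact: posdefmx_det_gt0.
rewrite AE det_rank1_update ?posdefmx_unit // mulrA mulrAC divff ?mul1r //.
by rewrite mulf_neq0 ?lt0r_neq0 // posdefmx_det_gt0.
Qed.

Theorem proposition3p2 (R : realType) (M l : nat) (hM : (1 <= M)%N)
    (hl : (1 <= l)%N) (Psi : 'M[R]_(M, l)) (Sigma_pr : 'M[R]_l)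
    (hpr : posdefmx Sigma_pr) (sigma : fidelity -> R)
    (hsigma_exp : 0 < sigma expensive)
    (hsigma_ch : sigma expensive < sigma cheap)
    (S S' : selection M)
    (disjS : [disjoint S cheap & S expensive])
    (disjS' : [disjoint S' cheap & S' expensive])
    (subS : forall j : fidelity, S j \subset S' j) :
  Phi_D Psi Sigma_pr sigma S <= Phi_D Psi Sigma_pr sigma S' /\
  forall (i : 'I_M) (j : fidelity), i \notin S' cheap :|: S' expensive ->
    Phi_D Psi Sigma_pr sigma (add_sensor S j i) - Phi_D Psi Sigma_pr sigma S >=
    Phi_D Psi Sigma_pr sigma (add_sensor S' j i) - Phi_D Psi Sigma_pr sigma S'.
Proof.
have s0 j : 0 < sigma j by case: j; first exact: lt_trans hsigma_ch.
have pA := inv_post_cov_posdef Psi S hpr s0.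
have pB := inv_post_cov_posdef Psi S' hpr s0.
have dS := posdefmx_det_gt0 hpr.
have [dAB qAB] := inv_post_cov_mono Psi hpr s0 subS.
split.
  rewrite !Phi_DE // ler_ln ?posrE ?mulr_gt0 ?posdefmx_det_gt0 //.
  by rewrite ler_pM2l.
move=> i j; rewrite in_setU negb_or => /andP[ich iex].
have iS' : i \notin S' j by case: j.
have iS : i \notin S j by apply: contra iS'; exact: subsetP (subS j) i.
have c0 : 0 <= (sigma j ^+ 2)^-1 by rewrite invr_ge0 sqr_ge0.
have gain_gt0 (A : 'M[R]_l) : posdefmx A ->
    0 < 1 + (sigma j ^+ 2)^-1 * qform (invmx A) (col i Psi^T).
  move=> /posdefmx_inv pV.
  by rewrite ltr_wpDr // mulr_ge0 // posdefmx_qform_ge0.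
rewrite !Phi_D_gain // ler_ln ?posrE ?gain_gt0 // lerD2l ler_wpM2l //.
exact: qform_inv_antitone.
Qed.
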